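(* Let $R$ be an integral domain and $M$ a nonzero, non-simple unital $R$-module. Then: (i) If $M$ is a uniserial module, then $D(M)$ is a $T_5$-space. (ii) If $M$ is a torsion free multiplication module that is not uniserial, then $D(M)$ is not a $T_5$-space.
   Context: For $m,n\in M$ write $m\mid n$ if $n=rm$ for some $r\in R$ (equivalently $Rn\subseteq Rm$). Put $M^{\#}=\{0\neq m\in M: Rm\neq M\}$ and define an equivalence relation on $M^{\#}$ by $m\sim n$ iff $Rm=Rn$; let $[m]$ be the class of $m$ and $\operatorname{EC}(M^{\#})=\{[m]:m\in M^{\#}\}$. For $m\in M^{\#}$ let $U_m=\{[n]\in \operatorname{EC}(M^{\#}): n\mid m\}$. The family $\{U_m\}_{m\in M^{\#}}$ is a basis of a topology on $\operatorname{EC}(M^{\#})$, called the divisor topology of $M$ and denoted $D(M)$ (also denoting the resulting space). $M$ is uniserial if any two of its submodules are comparable under inclusion. $M$ is torsion free if $rm=0$ with $r\in R$, $m\in M$ implies $r=0$ or $m=0$. $M$ is a multiplication module if each submodule $N$ of $M$ has the form $N=IM$ for some ideal $I$ of $R$. Two subsets $A,B$ of a topological space are separated if $A\cap\overline{B}=\emptyset$ and $\overline{A}\cap B=\emptyset$. A topological space is a $T_5$-space if any two separated sets are contained in disjoint open sets (no $T_1$ assumption is included). *)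

(* Defs.v *)
From HB Require Import structures.
From mathcomp Require Import all_boot all_order all_algebra.
From mathcomp Require Import boolp classical_sets topology.

Set Implicit Arguments.
Unset Strict Implicit.
Unset Printing Implicit Defensive.

Import GRing.Theory.
Local Open Scope ring_scope.
Local Open Scope classical_set_scope.
Local Open Scope quotient_scope.

Definition is_submodule (R : idomainType) (M : lmodType R) (N : set M) : Prop :=
  GRing.submod_closed [in N].

(* The library's idealr_closed forces ideals to be proper; here the unit ideal
   is allowed, so ideals are the submodules of the regular module. *)
Definition is_ideal (R : idomainType) (I : set R) : Prop :=
  @is_submodule R R^o I.

Definition ideal_mul (R : idomainType) (M : lmodType R) (I : set R) : set M :=
  [set x | exists (k : nat) (a : 'I_k -> R) (u : 'I_k -> M),
     (forall i, I (a i)) /\ x = \sum_(i < k) a i *: u i].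
Arguments ideal_mul {R} M I.

Definition simple_module (R : idomainType) (M : lmodType R) : Prop :=
  (exists m : M, m <> 0) /\
  forall N : set M, is_submodule N -> N = [set 0] \/ N = setT.

Definition uniserial (R : idomainType) (M : lmodType R) : Prop :=
  forall N1 N2 : set M, is_submodule N1 -> is_submodule N2 ->
    N1 `<=` N2 \/ N2 `<=` N1.

Definition torsion_free (R : idomainType) (M : lmodType R) : Prop :=
  forall (r : R) (m : M), r *: m = 0 -> r = 0 \/ m = 0.

Definition multiplication_module (R : idomainType) (M : lmodType R) : Prop :=
  forall N : set M, is_submodule N ->
    exists2 I : set R, is_ideal I & N = ideal_mul M I.

Definition T5_space (T : topologicalType) : Prop :=
  forall A B : set T, separated A B ->
    exists U V : set T,
      [/\ open U, open V, A `<=` U, B `<=` V & U `&` V = set0].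

Section DivisorTopology.
Variables (R : idomainType) (M : lmodType R).
Implicit Types m n : M.

Definition mdvd m n : Prop := exists r : R, n = r *: m.

Definition cyclic_sub m : set M := [set r *: m | r in [set: R]].

Definition Msharp : set M := [set m | m <> 0 /\ cyclic_sub m <> setT].

Definition assoc_rel : rel (set_type Msharp) :=
  [rel m n | cyclic_sub (\val m) == cyclic_sub (\val n)].

Lemma assoc_rel_equiv : equiv_class_of assoc_rel.
Proof.
split=> [m|m n|n m p]; [exact: eqxx | exact: eq_sym |].
by rewrite /assoc_rel /= => /eqP ->.
Qed.

Canonical assoc_equiv := EquivRelPack assoc_rel_equiv.

Definition EC := {eq_quot assoc_equiv}.
HB.instance Definition _ := Choice.on EC.
HB.instance Definition _ := EqQuotient.on EC.

Definition divisors_of (m : set_type Msharp) : set EC :=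
  [set \pi_EC n | n in [set n | mdvd (\val n) (\val m)]].

Lemma mdvd_refl m : mdvd m m.
Proof. by exists 1; rewrite scale1r. Qed.

Lemma mdvd_trans n m p : mdvd m n -> mdvd n p -> mdvd m p.
Proof. by move=> [r ->] [s ->]; exists (s * r); rewrite scalerA. Qed.

Lemma divisors_ofP (m n : set_type Msharp) :
  divisors_of m (\pi_EC n) <-> mdvd (\val n) (\val m).
Proof.
split=> [[p /= pm /eqmodP/eqP pn]|nm]; last by exists n.
apply: mdvd_trans pm; have : cyclic_sub (\val p) (\val p).
  by exists 1; rewrite ?scale1r.
by rewrite pn => -[r _ <-]; exists r.
Qed.

Lemma divisors_of_cover : \bigcup_(A in range divisors_of) A = setT.
Proof.
apply/seteqP; split=> // c _; elim/quotW: c => m.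
by exists (divisors_of m); [exists m | apply/divisors_ofP/mdvd_refl].
Qed.

Lemma divisors_of_join (A B : set EC) (c : EC) :
  range divisors_of A -> range divisors_of B -> A c -> B c ->
  exists C, [/\ range divisors_of C, C c & C `<=` A `&` B].
Proof.
move=> [m _ <-] [n _ <-]; elim/quotW: c => p /divisors_ofP pm /divisors_ofP pn.
exists (divisors_of p); split; [by exists p | exact/divisors_ofP/mdvd_refl |].
move=> d; elim/quotW: d => q /divisors_ofP qp.
by split; apply/divisors_ofP; apply: mdvd_trans qp _.
Qed.

(* The base is indexed by its own members: the factory wants a pointed index
   type, and Msharp may be empty. *)
HB.instance Definition _ :=
  isBaseTopological.Build EC (I := set EC) (D := range divisors_of) (b := id)
    divisors_of_cover divisors_of_join.

Definition divisor_space : topologicalType := EC.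

End DivisorTopology.

(* Main.v *)
(* In the divisor topology a point [m] has a least neighbourhood, the set of
   classes of divisors of m, so [n] is in the closure of [m] iff m divides n.
   If M is uniserial, divisibility is total and one of two separated sets must
   be empty. If M is not uniserial, pick x, y not dividing one another and a
   nonzero a in an ideal I with Rx = IM: then a y lies in IM = Rx, so the points
   [a x] and [a y] are separated (by torsion freeness) but [x] lies in every
   neighbourhood of either. *)
Require Import Defs.
From HB Require Import structures.
From mathcomp Require Import all_boot all_order all_algebra.
From mathcomp Require Import boolp classical_sets topology.

Local Open Scope ring_scope.

Import GRing.Theory.
Local Open Scope classical_set_scope.
Local Open Scope quotient_scope.

Section DivisorSpace.
Set Implicit Arguments.
Unset Strict Implicit.
Context {R : idomainType} {M : lmodType R}.
Implicit Types (x y z : M) (m n : set_type (@Msharp R M)).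

Lemma cyclic_subP x y : cyclic_sub x y <-> mdvd x y.
Proof. by split=> [[r _ <-]|[r ->]]; exists r. Qed.

Lemma submodule_mdvd (N : set M) x y :
  is_submodule N -> N x -> mdvd x y -> N y.
Proof.
move=> [N0 Nlin] Nx [r ->].
have /set_mem := Nlin r x 0 (mem_set Nx) N0.
by rewrite addr0.
Qed.

Lemma cyclic_sub_submodule x : is_submodule (cyclic_sub x).
Proof.
split; first by apply/mem_set; exists 0; rewrite ?scale0r.
move=> r y z /set_mem[s _ <-] /set_mem[t _ <-].
by apply/mem_set; exists (r * s + t); rewrite // scalerDl scalerA.
Qed.

Lemma uniserial_mdvd x y : uniserial M -> mdvd x y \/ mdvd y x.
Proof.
move=> /(_ _ _ (cyclic_sub_submodule x) (cyclic_sub_submodule y)).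
by case=> sub; [right|left]; apply/cyclic_subP/sub/cyclic_subP/mdvd_refl.
Qed.

(** A submodule contains every multiple of its elements, so elements witnessing the failure of the
    two inclusions between [N1] and [N2] cannot divide one another. *)
Lemma not_uniserial_mdvd :
  ~ uniserial M -> exists x y, ~ mdvd x y /\ ~ mdvd y x.
Proof.
move=> nuni; apply: contrapT => comparable; apply: nuni => N1 N2 sN1 sN2.
apply: contrapT => /not_orP[/existsNP[x /not_implyP[N1x N2x]]].
move=> /existsNP[y /not_implyP[N2y N1y]]; apply: comparable; exists x, y.
by split=> [/(submodule_mdvd sN1 N1x)|/(submodule_mdvd sN2 N2y)].
Qed.

(** If [z] generated [M], then [x], a divisor of [z], would divide everything, [y] included. *)
Lemma Msharp_mdvd x y z : ~ mdvd x y -> z <> 0 -> mdvd x z -> Msharp z.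
Proof.
move=> nxy z0 xz; split=> // zT; apply: nxy; apply: (mdvd_trans xz).
by apply/cyclic_subP; rewrite zT.
Qed.

Lemma divisors_of_open m : open (divisors_of m : set (divisor_space M)).
Proof. by exists [set divisors_of m]; [move=> _ ->; exists m|rewrite bigcup_set1]. Qed.

(** A basic open set around the class of [m] consists of the divisors of some multiple of [m], hence
    contains all divisors of [m]. *)
Lemma open_divisors_of (U : set (divisor_space M)) m :
  open U -> U (\pi_(EC M) m) -> divisors_of m `<=` U.
Proof.
case=> D' D'sub <- [A D'A].
have [n _ nA] := D'sub A D'A; rewrite -nA => /divisors_ofP mn.
move=> c; elim/quotW: c => p /divisors_ofP pm.
by exists A => //; rewrite -nA; apply/divisors_ofP/(mdvd_trans pm).
Qed.

Lemma closure_divisor_space (A : set (divisor_space M)) n :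
  closure A (\pi_(EC M) n) <->
  exists2 m, A (\pi_(EC M) m) & mdvd (\val m) (\val n).
Proof.
split=> [/(_ (divisors_of n))|[m Am mn] B].
  case=> [|c]; first by apply: open_nbhs_nbhs; split;
    [exact: divisors_of_open|exact/divisors_ofP/mdvd_refl].
  by elim/quotW: c => m [Am /divisors_ofP]; exists m.
rewrite nbhsE => -[U [oU Un] UB]; exists (\pi_(EC M) m); split=> //.
by apply/UB/(open_divisors_of oU Un)/divisors_ofP.
Qed.

Lemma separated_divisor_space (A B : set (divisor_space M)) m n :
  separated A B -> A (\pi_(EC M) m) -> B (\pi_(EC M) n) ->
  ~ mdvd (\val m) (\val n) /\ ~ mdvd (\val n) (\val m).
Proof.
move=> [AB BA] Am Bn; split=> dvd; [move: AB|move: BA]; apply/eqP/set0P.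
  by exists (\pi_(EC M) n); split=> //; apply/closure_divisor_space; exists m.
by exists (\pi_(EC M) m); split=> //; apply/closure_divisor_space; exists n.
Qed.

Lemma separated_points m n :
  ~ mdvd (\val m) (\val n) -> ~ mdvd (\val n) (\val m) ->
  separated ([set \pi_(EC M) m] : set (divisor_space M)) [set \pi_(EC M) n].
Proof.
have closure1 p q :
    closure ([set \pi_(EC M) p] : set (divisor_space M)) (\pi_(EC M) q) ->
    mdvd (\val p) (\val q).
  move=> /closure_divisor_space[p' pp' p'q].
  (* [p'] may be another representative of the class of [p]; membership in [divisors_of p'] depends
     only on the class, so [p] divides [p']. *)
  apply: (mdvd_trans _ p'q); apply/divisors_ofP; rewrite -pp'.
  exact/divisors_ofP/mdvd_refl.
by move=> mn nm; split; apply/seteqP; split=> // c [];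
  [move=> + cE|move=> cE]; rewrite cE => /closure1.
Qed.

Lemma uniserial_T5 : uniserial M -> T5_space (divisor_space M).
Proof.
move=> uni A B sepAB.
have [->|/set0P[a Aa]] := eqVneq A set0.
  by exists set0, setT; split; [exact: open0|exact: openT| | |rewrite set0I].
have [->|/set0P[b Bb]] := eqVneq B set0.
  by exists setT, set0; split; [exact: openT|exact: open0| | |rewrite setI0].
elim/quotW: a Aa => m Am; elim/quotW: b Bb => n Bn.
have [nmn nnm] := separated_divisor_space sepAB Am Bn.
by case: (uniserial_mdvd (\val m) (\val n) uni).
Qed.

(** Write Rx = IM. As a member of IM, [x] is a finite sum of terms [a i *: u i] with [a i] in I;
    since [x] is nonzero, so is some [a i], and this coefficient sends all of [M] into IM = Rx. *)
Lemma multiplication_mdvd x :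
  multiplication_module M -> x <> 0 ->
  exists2 a : R, a <> 0 & forall y, mdvd x (a *: y).
Proof.
move=> mult x0; have [I _ xI] := mult _ (cyclic_sub_submodule x).
have : ideal_mul M I x by rewrite -xI; apply/cyclic_subP/mdvd_refl.
case=> k [a [u [Ia xE]]].
have [i ai0] : exists i, a i <> 0.
  apply: contrapT => /forallNP a0; apply: x0; rewrite xE.
  by apply: big1 => i _; rewrite (contrapT (a0 i)) scale0r.
exists (a i) => // y; apply/cyclic_subP; rewrite xI.
by exists 1%N, (fun=> a i), (fun=> y); rewrite big_ord1.
Qed.

Lemma torsion_free_mdvdZ (a : R) x y :
  torsion_free M -> a <> 0 -> mdvd (a *: x) (a *: y) -> mdvd x y.
Proof.
(* Commutativity turns the equation into [a *: (y - r *: x) = 0], from which [a] cancels. *)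
move=> tf a0 [r /eqP]; rewrite scalerA mulrC -scalerA -subr_eq0 -scalerBr.
by move=> /eqP /tf[//|/eqP]; rewrite subr_eq0 => /eqP ->; exists r.
Qed.

Lemma not_uniserial_not_T5 :
  torsion_free M -> multiplication_module M -> ~ uniserial M ->
  ~ T5_space (divisor_space M).
Proof.
move=> tf mult /not_uniserial_mdvd[x [y [nxy nyx]]] T5.
have x0 : x <> 0 by move=> x0; apply: nyx; exists 0; rewrite x0 scale0r.
have y0 : y <> 0 by move=> y0; apply: nxy; exists 0; rewrite y0 scale0r.
have [a a0 xa] := multiplication_mdvd mult x0.
have ax0 : a *: x <> 0 by move=> /tf[].
have ay0 : a *: y <> 0 by move=> /tf[].
(* The three points are nonzero multiples of [x], which does not divide [y], so none of them
   generates [M]. *)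
pose p : set_type (@Msharp R M) :=
  SigSub (mem_set (Msharp_mdvd nxy x0 (mdvd_refl x))).
pose m : set_type (@Msharp R M) :=
  SigSub (mem_set (Msharp_mdvd nxy ax0 (xa x))).
pose n : set_type (@Msharp R M) :=
  SigSub (mem_set (Msharp_mdvd nxy ay0 (xa y))).
have nmn : ~ mdvd (\val m) (\val n) by move=> /(torsion_free_mdvdZ tf a0).
have nnm : ~ mdvd (\val n) (\val m) by move=> /(torsion_free_mdvdZ tf a0).
have [U [V [oU oV mU nV UV0]]] := T5 _ _ (separated_points nmn nnm).
suff : (U `&` V) (\pi_(EC M) p) by rewrite UV0.
by split; [apply: (open_divisors_of oU (mU _ erefl))
          |apply: (open_divisors_of oV (nV _ erefl))];
  apply/divisors_ofP/xa.
Qed.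

End DivisorSpace.

Theorem proposition9 (R : idomainType) (M : lmodType R)
    (M_nonzero : exists m : M, m <> 0) (M_nonsimple : ~ simple_module M) :
  (uniserial M -> T5_space (divisor_space M)) /\
  (torsion_free M -> multiplication_module M -> ~ uniserial M ->
     ~ T5_space (divisor_space M)).
Proof. by split; [exact: uniserial_T5|exact: not_uniserial_not_T5]. Qed.
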